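(* Let $\Omega^{(0)},\dots,\Omega^{(M)}$ be a hierarchy of three-dimensional grids with grid sizes $h^{(m)}=2^m h^{(0)}$, $h=h^{(0)}$, with linear systems $L^{(m)}\hat\varphi^{(m)}=\hat s^{(m)}$ whose exact solutions are $\hat\varphi^{(m)}$, and let $I_{m+1}^m$ be the interpolation (prolongation) operator from $\Omega^{(m+1)}$ to $\Omega^{(m)}$. Suppose there is a constant $C>0$ such that $\|I_{m+1}^m\phi^{(m+1)}\|\le C\|\phi^{(m+1)}\|$ for all grid functions $\phi^{(m+1)}$ on $\Omega^{(m+1)}$, and a constant $K>0$ independent of the grid size such that $\|I_{m+1}^m\hat\varphi^{(m+1)}-\hat\varphi^{(m)}\|\le K(h^{(m)})^p$, where $p$ is the order of accuracy of the discrete Laplacian. Suppose also that one V-cycle on $\Omega^{(m)}$ reduces the norm of the algebraic error by a factor at most $\gamma<1$ independent of the grid size. Then for any $\epsilon>0$, the FMG cycle, with an appropriate constant number $I_{\text{V-cycle}}$ of V-cycles per level (independent of the grid size), can reduce the algebraic error $\|\hat\psi^{(0)}-\hat\varphi^{(0)}\|$ of the computed solution $\hat\psi^{(0)}$ from $O(1)$ to $\epsilon$ with a complexity of $O(1/h^3)$ operations.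
   Context: The FMG (full multigrid) cycle computes $\hat\psi^{(m)}$ recursively. On the coarsest level $m=M$ the system $L^{(M)}\hat\varphi^{(M)}=\hat s^{(M)}$ is solved exactly by a direct solver, so $\hat\psi^{(M)}=\hat\varphi^{(M)}$. For $m<M$, the right-hand side is restricted, $\hat s^{(m+1)}=\mathrm{Restrict}(\hat s^{(m)})$; FMG is applied recursively to $L^{(m+1)}\hat\varphi^{(m+1)}=\hat s^{(m+1)}$, giving $\hat\psi^{(m+1)}$; then $I_{m+1}^m\hat\psi^{(m+1)}$ is taken as initial guess on $\Omega^{(m)}$ and $I_{\text{V-cycle}}$ V-cycles for $L^{(m)}\hat\varphi^{(m)}=\hat s^{(m)}$ are performed, giving $\hat\psi^{(m)}$. A V-cycle is one step of a (linear, stationary) iteration for the system on $\Omega^{(m)}$. The norms are fixed norms on the spaces of grid functions. Cost model: grid $\Omega^{(m)}$ has $O((h^{(m)})^{-3})$ unknowns; one V-cycle on $\Omega^{(m)}$ (including the required factorizations), one restriction and one prolongation each cost $O((h^{(m)})^{-3})$ operations, with constants independent of $m$ and $h$; the number of cells of the coarsest grid $\Omega^{(M)}$, and hence the cost of the direct solve there, is bounded by a fixed constant. The grid sizes $h^{(m)}$ are bounded above by a fixed constant. The implied constant in $O(1/h^3)$ is independent of $h$ (it may depend on $\epsilon$). *)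

(* Defs.v *)
From mathcomp Require Import all_boot all_order all_algebra.
From mathcomp Require Import finmap reals.

Set Implicit Arguments.
Unset Strict Implicit.
Unset Printing Implicit Defensive.

Import Order.TTheory GRing.Theory Num.Theory.
Local Open Scope ring_scope.

(* Real functions on a finite set of points of R^3; R^o gives the space its
   module structure over R. *)
Definition gridfun_on (R : realType) (G : {fset 'rV[R]_3}) : lmodType R :=
  {ffun G -> R^o}.

Definition is_norm (R : realType) (V : lmodType R) (N : V -> R) : Prop :=
  [/\ forall u v, N (u + v) <= N u + N v,
      forall (a : R) u, N (a *: u) = `|a| * N u
    & forall u, N u = 0 -> u = 0].

(* Level-indexed families range over all of nat in order to avoid casts; the
   components at levels m > hdepth H are never used. *)
Record hierarchy (R : realType) := Hierarchy {
  hdepth : nat; (* M *)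
  hsize0 : R; (* h = h^(0) *)
  hsize0_gt0 : 0 < hsize0;
  hgrid : nat -> {fset 'rV[R]_3};
  hnorm : forall m, gridfun_on (hgrid m) -> R;
  hnormP : forall m, is_norm (@hnorm m);
  hop : forall m, {linear gridfun_on (hgrid m) -> gridfun_on (hgrid m)};
  hprolong : forall m, {linear gridfun_on (hgrid m.+1) -> gridfun_on (hgrid m)};
  hrestrict : forall m, gridfun_on (hgrid m) -> gridfun_on (hgrid m.+1);
  (* One V-cycle for L u = s is u |-> G u + N s, with the stationary linear
     maps G = hvmat and N = hvrhs; consistency says that every solution u of
     L u = s is a fixed point. *)
  hvmat : forall m, {linear gridfun_on (hgrid m) -> gridfun_on (hgrid m)};
  hvrhs : forall m, {linear gridfun_on (hgrid m) -> gridfun_on (hgrid m)};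
  hvconsistent : forall m u, hvmat m u + hvrhs m (hop m u) = u;
  (* Only the direct solver of level hdepth is run. *)
  hdirect : forall m, gridfun_on (hgrid m) -> gridfun_on (hgrid m);
  (* Operation counts; hrcost m and hpcost m are for the transfers between
     levels m and m.+1. *)
  hvcost : nat -> nat;
  hrcost : nat -> nat;
  hpcost : nat -> nat;
  hdcost : nat
}.

Section FMG.
Variables (R : realType) (H : hierarchy R).

Definition gridfun (m : nat) : lmodType R := gridfun_on (hgrid H m).

Definition hsize (m : nat) : R := 2 ^+ m * hsize0 H.

Fixpoint rhs (s : gridfun 0) (m : nat) : gridfun m :=
  match m with
  | 0%N => s
  | m'.+1 => @hrestrict R H m' (rhs s m')
  end.

Definition vcycle (m : nat) (s u : gridfun m) : gridfun m :=
  hvmat H m u + hvrhs H m s.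

(* FMG on level m with k coarser levels below it and I V-cycles per level,
   together with its operation count. *)
Fixpoint fmg (I k m : nat) (s : gridfun m) : gridfun m * nat :=
  match k with
  | 0%N => (@hdirect R H m s, hdcost H)
  | k'.+1 =>
      let r := fmg I k' (@hrestrict R H m s) in
      (iter I (vcycle s) (hprolong H m r.1),
       (hrcost H m + r.2 + hpcost H m + I * hvcost H m)%N)
  end.

Definition fmg_solution (I : nat) (s : gridfun 0) : gridfun 0 :=
  (fmg I (hdepth H) s).1.

Definition fmg_cost (I : nat) (s : gridfun 0) : nat :=
  (fmg I (hdepth H) s).2.

(* The iterate from which the V-cycles on the finest grid start; it is
   meaningful when 0 < hdepth H. *)
Definition fmg_guess (I : nat) (s : gridfun 0) : gridfun 0 :=
  hprolong H 0 (fmg I (hdepth H).-1 (@hrestrict R H 0 s)).1.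

Definition exact_solutions (s : gridfun 0) (phi : forall m, gridfun m) : Prop :=
  forall m, (m <= hdepth H)%N -> hop H m (phi m) = rhs s m.

Definition coarsest_solve_exact (s : gridfun 0) (phi : forall m, gridfun m) :
    Prop :=
  @hdirect R H (hdepth H) (rhs s (hdepth H)) = phi (hdepth H).

Definition prolong_bounded (C : R) : Prop :=
  forall m, (m < hdepth H)%N -> forall u : gridfun m.+1,
    hnorm (hprolong H m u) <= C * hnorm u.

Definition prolong_accurate (K : R) (p : nat) (phi : forall m, gridfun m) :
    Prop :=
  forall m, (m < hdepth H)%N ->
    hnorm (hprolong H m (phi m.+1) - phi m) <= K * hsize m ^+ p.

Definition vcycle_reduces (gamma : R) (s : gridfun 0)
    (phi : forall m, gridfun m) : Prop :=
  forall m, (m < hdepth H)%N -> forall u : gridfun m,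
    hnorm (vcycle (rhs s m) u - phi m) <= gamma * hnorm (u - phi m).

Record cost_model (cN cV cR cP hmax : R) (Nmax Dmax : nat) : Prop := CostModel {
  cost_unknowns : forall m, (m <= hdepth H)%N ->
    #|` hgrid H m|%:R <= cN * hsize m ^- 3;
  cost_vcycle : forall m, (m < hdepth H)%N ->
    (hvcost H m)%:R <= cV * hsize m ^- 3;
  cost_restrict : forall m, (m < hdepth H)%N ->
    (hrcost H m)%:R <= cR * hsize m ^- 3;
  cost_prolong : forall m, (m < hdepth H)%N ->
    (hpcost H m)%:R <= cP * hsize m ^- 3;
  cost_coarsest_cells : (#|` hgrid H (hdepth H)| <= Nmax)%N;
  cost_direct : (hdcost H <= Dmax)%N;
  cost_hsize : forall m, (m <= hdepth H)%N -> hsize m <= hmax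
}.

End FMG.

(* Main.v *)
(** On each level the initial guess has error at most [C d + K hmax^p] when the
    coarser level has error at most [d].  Taking [I] with
    [gamma^I (C + K hmax^p) <= min eps 1] makes [I] V-cycles bring this back
    below [min eps 1], so the bound survives the whole recursion.  The work on
    level [m] is [O(8^-m / h^3)], a convergent geometric series, and the
    bounded direct solve is absorbed because [h <= hmax]. *)

Require Import Defs.
From mathcomp Require Import all_boot all_order all_algebra.
From mathcomp Require Import finmap reals ring lra.

Set Implicit Arguments.
Unset Strict Implicit.
Unset Printing Implicit Defensive.

Import Order.TTheory GRing.Theory Num.Theory.
Local Open Scope ring_scope.

(** Bernoulli's inequality in the form [g^n (1 + n (1 - g)) <= 1] gives an explicit decay rate, so
    the Archimedean property suffices to find [n]. *)
Lemma geometric_le (R : realType) (g D d : R) :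
  0 <= g -> g < 1 -> 0 < d -> exists n : nat, g ^+ n * D <= d.
Proof.
move=> g0 g1 d0; have t0 : 0 < 1 - g by lra.
have bernoulli n : g ^+ n * (1 + n%:R * (1 - g)) <= 1.
  elim: n => [|n IH]; first by rewrite expr0 mul0r; lra.
  have gX : g ^+ n.+1 <= 1 by rewrite exprn_ile1 // ltW.
  have gIH : g * (g ^+ n * (1 + n%:R * (1 - g))) <= g * 1 by rewrite ler_wpM2l.
  have gXt : g ^+ n.+1 * (1 - g) <= 1 * (1 - g) by rewrite ler_wpM2r // ltW.
  have -> : g ^+ n.+1 * (1 + n.+1%:R * (1 - g)) =
      g * (g ^+ n * (1 + n%:R * (1 - g))) + g ^+ n.+1 * (1 - g).
    by rewrite exprS -[n.+1%:R]natr1; ring.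
  lra.
(* This [n] makes [n d (1 - g)] exceed [D]. *)
pose n := Num.bound `|D / (d * (1 - g))|; exists n.
have gn0 : 0 <= g ^+ n by rewrite exprn_ge0.
have Dn : D <= d * (1 + n%:R * (1 - g)).
  have : D / (d * (1 - g)) < n%:R.
    exact: le_lt_trans (ler_norm _) (archi_boundP (normr_ge0 _)).
  rewrite ltr_pdivrMr ?mulr_gt0 // => /ltW; lra.
rewrite (le_trans (ler_wpM2l gn0 Dn)) // mulrCA.
by rewrite -[leRHS]mulr1 ler_wpM2l // ltW.
Qed.

(** Subadditivity and [N (- u) = N u] give [0 = N (u - u) <= 2 N u]. *)
Lemma is_norm_ge0 (R : realType) (V : lmodType R) (N : V -> R) :
  is_norm N -> forall u, 0 <= N u.
Proof.
case=> ND NZ _ u.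
have N0 : N 0 = 0 by rewrite -(scale0r 0) NZ normr0 mul0r.
have NN : N (- u) = N u by rewrite -scaleN1r NZ normrN1 mul1r.
have := ND u (- u); rewrite subrr N0 NN; lra.
Qed.

Section FMGBounds.
Variables (R : realType) (H : hierarchy R) (p : nat) (C K : R).
Variables (s : gridfun H 0) (phi : forall m, gridfun H m).
Implicit Types (g d hmax : R) (k m I : nat).

Lemma hsize_gt0 m : 0 < hsize H m.
Proof. by rewrite mulr_gt0 ?hsize0_gt0 ?exprn_gt0. Qed.

Lemma vcycle_iter_le g m n (u : gridfun H m) : 0 <= g -> (m < hdepth H)%N ->
  vcycle_reduces g s phi ->
  hnorm (iter n (vcycle (rhs s m)) u - phi m) <= g ^+ n * hnorm (u - phi m).
Proof.
move=> g0 mM red; elim: n => [|n IH]; first by rewrite expr0 mul1r.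
by rewrite iterS (le_trans (red _ mM _)) // exprS -mulrA ler_wpM2l.
Qed.

(** Linearity splits the error into the prolonged coarse error and the interpolation error of the
    exact solution. *)
Lemma prolong_error hmax m (u : gridfun H m.+1) : 0 < K ->
  (m < hdepth H)%N -> prolong_bounded H C -> prolong_accurate K p phi ->
  hsize H m <= hmax ->
  hnorm (hprolong H m u - phi m) <= C * hnorm (u - phi m.+1) + K * hmax ^+ p.
Proof.
move=> K0 mM bnd acc hm; have [ND _ _] := hnormP H m.
have -> : hprolong H m u - phi m =
    hprolong H m (u - phi m.+1) + (hprolong H m (phi m.+1) - phi m).
  by rewrite raddfB addrA subrK.
rewrite (le_trans (ND _ _)) // lerD ?bnd // (le_trans (acc _ mM)) //.
have h0 := ltW (hsize_gt0 m).
by rewrite ler_pM2l // lerXn2r // nnegrE // (le_trans h0).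
Qed.

(* Any [d <= 1] with [g ^+ I * (C + K hmax^p) <= d] propagates from level
   [m.+1] to level [m], so one [I] serves every level. *)
Lemma fmg_error g hmax d I k m : 0 <= g -> 0 < C -> 0 < K -> 0 <= d -> d <= 1 ->
  g ^+ I * (C + K * hmax ^+ p) <= d ->
  coarsest_solve_exact s phi -> prolong_bounded H C ->
  prolong_accurate K p phi -> vcycle_reduces g s phi ->
  (forall j, (j <= hdepth H)%N -> hsize H j <= hmax) ->
  (m + k)%N = hdepth H ->
  hnorm ((fmg I k (rhs s m)).1 - phi m) <= d.
Proof.
move=> g0 C0 K0 d0 d1 gI exact bnd acc red hmaxP.
elim: k m => [|k IH] m /=.
  rewrite addn0 => ->; rewrite exact subrr.
  have [_ NZ _] := hnormP H (hdepth H).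
  by rewrite -(scale0r 0) NZ normr0 mul0r.
move=> mk; have mM : (m < hdepth H)%N by rewrite -mk addnS ltnS leq_addr.
rewrite (le_trans (vcycle_iter_le _ _ g0 mM red)) //.
apply: le_trans gI; rewrite ler_wpM2l ?exprn_ge0 //.
rewrite (le_trans (prolong_error _ K0 mM bnd acc (hmaxP _ (ltnW mM)))) //.
(* The coarse error is at most [d <= 1], so [C] times it is at most [C]. *)
rewrite lerD2r -[leRHS]mulr1 ler_pM2l // (le_trans _ d1) //.
by apply: IH; rewrite addSnnS.
Qed.

(* [2 B] is not sharp: the geometric series in the ratio [2^-3] sums to
   [8/7]. *)
Lemma fmg_cost_le (B : R) I k m (t : gridfun H m) : 0 <= B ->
  (forall j, (j < hdepth H)%N ->
    (hrcost H j + hpcost H j + I * hvcost H j)%:R <= B * hsize H j ^- 3) ->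
  (m + k)%N = hdepth H ->
  (fmg I k t).2%:R <= 2 * B * hsize H m ^- 3 + (hdcost H)%:R.
Proof.
move=> B0 costB; elim: k m t => [|k IH] m t /= mk.
  have := hsize_gt0 m => h0.
  by rewrite lerDr mulr_ge0 ?mulr_ge0 // invr_ge0 exprn_ge0 // ltW.
have mM : (m < hdepth H)%N by rewrite -mk addnS ltnS leq_addr.
have {}IH := IH _ (hrestrict t) (etrans (addSnnS _ _) mk).
have {}costB := costB _ mM.
(* Doubling the grid size divides the work by 8, and [B + 2 B / 8 <= 2 B] closes the induction. *)
have hS : hsize H m.+1 ^- 3 = 8^-1 * hsize H m ^- 3.
  have -> : hsize H m.+1 = 2 * hsize H m by rewrite /hsize exprS mulrA.
  by rewrite exprMn invfM -natrX.
have B3 : 0 <= B * hsize H m ^- 3.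
  by rewrite mulr_ge0 // invr_ge0 exprn_ge0 // ltW // hsize_gt0.
move: IH costB; rewrite hS !natrD; lra.
Qed.

End FMGBounds.

Theorem corollary5p7 (R : realType) (p : nat)
    (C K gamma cN cV cR cP hmax : R) (Nmax Dmax : nat)
    (C_gt0 : 0 < C) (K_gt0 : 0 < K) (gamma_lt1 : gamma < 1) :
  exists E0 : R, forall eps : R, 0 < eps ->
  exists (I : nat) (A : R),
  forall (H : hierarchy R) (s : gridfun H 0) (phi : forall m, gridfun H m),
    exact_solutions s phi ->
    coarsest_solve_exact s phi ->
    prolong_bounded H C ->
    prolong_accurate K p phi ->
    vcycle_reduces gamma s phi ->
    cost_model H cN cV cR cP hmax Nmax Dmax ->
    [/\ (0 < hdepth H)%N -> hnorm (fmg_guess I s - phi 0%N) <= E0,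
        hnorm (fmg_solution I s - phi 0%N) <= eps
      & (fmg_cost I s)%:R <= A / hsize H 0 ^+ 3].
Proof.
(* [gamma] may be negative; since norms are nonnegative, [g] is a reduction factor as well. *)
pose g := Num.max gamma 0.
have g0 : 0 <= g by rewrite le_max lexx orbT.
have g1 : g < 1 by rewrite gt_max gamma_lt1 ltr01.
(* The cap [d <= 1] below is what keeps this bound on the initial error independent of [eps]. *)
exists (C + K * hmax ^+ p) => eps eps0.
pose d := Num.min eps 1.
have d0 : 0 < d by rewrite lt_min eps0 ltr01.
have deps : d <= eps by rewrite ge_min lexx.
have d1 : d <= 1 by rewrite ge_min lexx orbT.
have [I gI] := geometric_le (C + K * hmax ^+ p) g0 g1 d0.
(* The cost constants have no prescribed sign, hence the absolute values. *)
pose B := `|cR| + `|cP| + I%:R * `|cV|.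
have B0 : 0 <= B by rewrite !addr_ge0 // mulr_ge0.
(* The second term pays for the direct solve: [1 <= hmax^3 / h^3]. *)
exists I, (2 * B + Dmax%:R * hmax ^+ 3) => H s phi _ exact bnd acc red cost.
have hmaxP := cost_hsize cost.
have {}red : vcycle_reduces g s phi.
  move=> m mM u; rewrite (le_trans (red m mM u)) // ler_wpM2r ?le_max ?lexx //.
  exact: is_norm_ge0 (hnormP H m) _.
have err k m := @fmg_error _ H p C K s phi g hmax d I k m g0 C_gt0 K_gt0
  (ltW d0) d1 gI exact bnd acc red hmaxP.
split.
- move=> M0.
  rewrite (le_trans (prolong_error _ K_gt0 M0 bnd acc (hmaxP _ (ltnW M0)))) //.
  rewrite lerD2r -[leRHS]mulr1 ler_pM2l // (le_trans _ d1) //.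
  by apply: (err (hdepth H).-1 1%N); rewrite add1n prednK.
- by rewrite (le_trans _ deps) // (err (hdepth H) 0%N).
- have costB j : (j < hdepth H)%N ->
      (hrcost H j + hpcost H j + I * hvcost H j)%:R <= B * hsize H j ^- 3.
    move=> jM; have h3 : 0 <= hsize H j ^- 3.
      by rewrite invr_ge0 exprn_ge0 // ltW // hsize_gt0.
    have absM c : c * hsize H j ^- 3 <= `|c| * hsize H j ^- 3.
      by rewrite ler_wpM2r // ler_norm.
    rewrite !natrD natrM /B !mulrDl -mulrA !lerD //.
    + exact: le_trans (cost_restrict cost jM) (absM _).
    + exact: le_trans (cost_prolong cost jM) (absM _).
    + by rewrite ler_wpM2l // (le_trans (cost_vcycle cost jM)).
  rewrite (le_trans (fmg_cost_le s B0 costB (add0n _))) // [leRHS]mulrDl lerD2l.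
  have h0 := hsize_gt0 H 0; have hm := hmaxP 0%N (leq0n _).
  rewrite ler_pdivlMr ?exprn_gt0 // ler_pM ?ler_nat ?(cost_direct cost) //.
    by rewrite exprn_ge0 // ltW.
  by rewrite lerXn2r // nnegrE ltW // (lt_le_trans h0).
Qed.
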